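(* For every $\mathrm{ML}(\mathsf{A}^+)$-formula $\varphi$ there exists an $\mathrm{ML}(\mathsf{A}^+)$-formula $\psi$ in $\mathsf{A}$-form such that $\varphi$ and $\psi$ are equivalent in Kripke semantics, i.e., $\mathfrak{M},w\Vdash\varphi \Leftrightarrow \mathfrak{M},w\Vdash\psi$ for every Kripke model $\mathfrak{M}$ and every point $w$ of $\mathfrak{M}$.
   Context: Fix a set $\Phi$ of propositional variables. $\mathrm{ML}$-formulas: $\varphi ::= p \mid \neg p \mid (\varphi\wedge\varphi)\mid(\varphi\vee\varphi)\mid\Diamond\varphi\mid\Box\varphi$, $p\in\Phi$. $\mathrm{ML}(\mathsf{A}^+)$ extends this grammar by $\varphi::=\mathsf{A}\varphi$, with Kripke semantics $\mathfrak{M},w\Vdash\mathsf{A}\varphi$ iff $\mathfrak{M},v\Vdash\varphi$ for every point $v$ of $\mathfrak{M}$. A disjunctive $\mathsf{A}$-clause is a formula $\psi\vee\mathsf{A}\psi_1\vee\dots\vee\mathsf{A}\psi_n$ with $n\in\omega$ and $\psi,\psi_1,\dots,\psi_n\in\mathrm{ML}$; a conjunctive $\mathsf{A}$-clause is a formula $\psi\wedge\mathsf{A}\psi_1$ with $\psi,\psi_1\in\mathrm{ML}$. A formula is in conjunctive $\mathsf{A}$-form if it is a conjunction of disjunctive $\mathsf{A}$-clauses, in disjunctive $\mathsf{A}$-form if it is a disjunction of conjunctive $\mathsf{A}$-clauses, and in $\mathsf{A}$-form if it is in conjunctive or disjunctive $\mathsf{A}$-form. *)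

(* Defs.v *)
From Stdlib Require Import List.

Set Implicit Arguments.
Unset Strict Implicit.
Unset Printing Implicit Defensive.

(* The set of propositional variables is an arbitrary type [Phi].  As in the
   negation normal form grammar, negation applies to variables only and there
   are no constants for truth and falsity. *)
Inductive formula (Phi : Type) : Type :=
| Var : Phi -> formula Phi
| NegVar : Phi -> formula Phi
| And : formula Phi -> formula Phi -> formula Phi
| Or : formula Phi -> formula Phi -> formula Phi
| Dia : formula Phi -> formula Phi
| Box : formula Phi -> formula Phi
| All : formula Phi -> formula Phi.

Fixpoint is_ML (Phi : Type) (f : formula Phi) : Prop :=
  match f with
  | Var _ | NegVar _ => True
  | And g h | Or g h => is_ML g /\ is_ML h
  | Dia g | Box g => is_ML g
  | All _ => False
  end.

(* Non-emptiness of the domain is not a field: satisfaction is only ever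
   evaluated at a point of the model. *)
Record kripke_model (Phi : Type) : Type := KripkeModel {
  point :> Type;
  rel : point -> point -> Prop;
  val : Phi -> point -> Prop
}.

Fixpoint sat (Phi : Type) (M : kripke_model Phi) (w : M) (f : formula Phi)
  : Prop :=
  match f with
  | Var p => val p w
  | NegVar p => ~ val p w
  | And g h => sat w g /\ sat w h
  | Or g h => sat w g \/ sat w h
  | Dia g => exists v : M, rel w v /\ sat v g
  | Box g => forall v : M, rel w v -> sat v g
  | All g => forall v : M, sat v g
  end.

(* Conjunctions and disjunctions of several formulas are non-empty and
   associate to the left: [bigOr f (g :: h :: nil)] is [Or (Or f g) h]. *)
Definition bigAnd (Phi : Type) (f : formula Phi) (fs : list (formula Phi))
  : formula Phi := fold_left (@And Phi) fs f.

Definition bigOr (Phi : Type) (f : formula Phi) (fs : list (formula Phi))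
  : formula Phi := fold_left (@Or Phi) fs f.

Definition disjunctive_clause (Phi : Type) (f : formula Phi) : Prop :=
  exists (g : formula Phi) (gs : list (formula Phi)),
    is_ML g /\ Forall (@is_ML Phi) gs /\ f = bigOr g (map (@All Phi) gs).

Definition conjunctive_clause (Phi : Type) (f : formula Phi) : Prop :=
  exists g h : formula Phi, is_ML g /\ is_ML h /\ f = And g (All h).

Definition conjunctive_form (Phi : Type) (f : formula Phi) : Prop :=
  exists (c : formula Phi) (cs : list (formula Phi)),
    Forall (@disjunctive_clause Phi) (c :: cs) /\ f = bigAnd c cs.

Definition disjunctive_form (Phi : Type) (f : formula Phi) : Prop :=
  exists (c : formula Phi) (cs : list (formula Phi)),
    Forall (@conjunctive_clause Phi) (c :: cs) /\ f = bigOr c cs.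

Definition A_form (Phi : Type) (f : formula Phi) : Prop :=
  conjunctive_form f \/ disjunctive_form f.

Definition kripke_equiv (Phi : Type) (f g : formula Phi) : Prop :=
  forall (M : kripke_model Phi) (w : M), sat w f <-> sat w g.

(* Main.v *)
(* Every formula is brought into disjunctive A-form by induction.  The cases of
   the lattice connectives and of the diamond are distributive laws.  For a
   universal quantifier Q (Box or A), the truth value of [A h] does not depend
   on the point, so
     Q (d \/ (g /\ A h) \/ b)  <->  (Q (d \/ g \/ b) /\ A h) \/ Q (d \/ b),
   which removes the clauses under Q one at a time. *)

Require Import Defs.
From Stdlib Require Import List Classical.

(** An inductive form of [disjunctive_form], nested to the left like [bigOr], so that inductions
    peel off the last clause. *)
Inductive clauses {Phi : Type} : formula Phi -> Prop :=
| clauses_one g h : is_ML g -> is_ML h -> clauses (And g (All h))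
| clauses_or d g h :
    clauses d -> is_ML g -> is_ML h -> clauses (Or d (And g (All h))).

Lemma clauses_disjunctive_form {Phi : Type} (d : formula Phi) :
  clauses d -> disjunctive_form d.
Proof.
  induction 1 as [g h Hg Hh | d g h Hd IH Hg Hh].
  - exists (And g (All h)), nil; split; [|reflexivity].
    constructor; [exists g, h; auto | constructor].
  - destruct IH as (c & cs & Hcs & ->).
    exists c, (cs ++ And g (All h) :: nil); split.
    + rewrite app_comm_cons; apply Forall_app; split; [assumption|].
      constructor; [exists g, h; auto | constructor].
    + unfold bigOr; rewrite fold_left_app; reflexivity.
Qed.

Definition normalizable {Phi : Type} (f : formula Phi) : Prop :=
  exists d, clauses d /\ kripke_equiv f d.

Lemma normalizable_equiv {Phi : Type} (f g : formula Phi) :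
  kripke_equiv f g -> normalizable g -> normalizable f.
Proof.
  intros Hfg (d & Hd & Hgd); exists d; split; [assumption|].
  intros M w; rewrite (Hfg M w); apply Hgd.
Qed.

Lemma normalizable_clause {Phi : Type} (g h : formula Phi) :
  is_ML g -> is_ML h -> normalizable (And g (All h)).
Proof.
  intros Hg Hh; exists (And g (All h)); split; [now constructor|].
  intros M w; reflexivity.
Qed.

(** Disjunctions must nest to the left, so the clauses of the second disjunct are appended to the
    first one at a time. *)
Lemma normalizable_or {Phi : Type} (f g : formula Phi) :
  normalizable f -> normalizable g -> normalizable (Or f g).
Proof.
  intros Hf (e & He & Hge).
  apply normalizable_equiv with (g := Or f e).
  { intros M w; simpl; rewrite (Hge M w); reflexivity. }
  clear g Hge; induction He as [g h Hg Hh | e g h He IH Hg Hh].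
  - destruct Hf as (d & Hd & Hfd).
    exists (Or d (And g (All h))); split; [now constructor|].
    intros M w; simpl; rewrite (Hfd M w); reflexivity.
  - destruct IH as (d & Hd & Hed).
    exists (Or d (And g (All h))); split; [now constructor|].
    intros M w; specialize (Hed M w); simpl in *; tauto.
Qed.

Lemma normalizable_and_clause {Phi : Type} (f g h : formula Phi) :
  normalizable f -> is_ML g -> is_ML h -> normalizable (And f (And g (All h))).
Proof.
  intros (d & Hd & Hfd) Hg Hh.
  apply normalizable_equiv with (g := And d (And g (All h))).
  { intros M w; simpl; rewrite (Hfd M w); reflexivity. }
  clear f Hfd.
  assert (Hclause : forall g' h' : formula Phi, is_ML g' -> is_ML h' ->
            normalizable (And (And g' (All h')) (And g (All h)))).
  { intros g' h' Hg' Hh'.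
    (* [All] commutes with conjunction, so two clauses merge into one. *)
    apply normalizable_equiv with (g := And (And g' g) (All (And h' h))).
    - intros M w; simpl; firstorder.
    - now apply normalizable_clause. }
  induction Hd as [g' h' Hg' Hh' | d g' h' Hd IH Hg' Hh']; [now apply Hclause|].
  apply normalizable_equiv with
    (g := Or (And d (And g (All h))) (And (And g' (All h')) (And g (All h)))).
  - intros M w; simpl; tauto.
  - apply normalizable_or; auto.
Qed.

Lemma normalizable_and {Phi : Type} (f g : formula Phi) :
  normalizable f -> normalizable g -> normalizable (And f g).
Proof.
  intros Hf (e & He & Hge).
  apply normalizable_equiv with (g := And f e).
  { intros M w; simpl; rewrite (Hge M w); reflexivity. }
  clear g Hge; induction He as [g h Hg Hh | e g h He IH Hg Hh].
  - now apply normalizable_and_clause.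
  - apply normalizable_equiv with
      (g := Or (And f e) (And f (And g (All h)))).
    + intros M w; simpl; tauto.
    + apply normalizable_or; [assumption | now apply normalizable_and_clause].
Qed.

Lemma normalizable_dia {Phi : Type} (f : formula Phi) :
  normalizable f -> normalizable (Dia f).
Proof.
  intros (d & Hd & Hfd).
  apply normalizable_equiv with (g := Dia d).
  { intros M w; split; intros (v & Hv & Hs);
      exists v; split; auto; now apply Hfd. }
  clear f Hfd.
  assert (Hclause : forall g h : formula Phi, is_ML g -> is_ML h ->
            normalizable (Dia (And g (All h)))).
  { intros g h Hg Hh.
    (* [All h] holds at all points or at none, so it moves out of the diamond. *)
    apply normalizable_equiv with (g := And (Dia g) (All h)).
    - intros M w; simpl; firstorder.
    - now apply normalizable_clause. }
  induction Hd as [g h Hg Hh | d g h Hd IH Hg Hh]; [now apply Hclause|].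
  apply normalizable_equiv with (g := Or (Dia d) (Dia (And g (All h)))).
  - intros M w; simpl; firstorder.
  - apply normalizable_or; auto.
Qed.

(* The grammar has no constants, so truth and falsity have to be expressed with
   a variable, which every formula provides. *)
Fixpoint some_var {Phi : Type} (f : formula Phi) : Phi :=
  match f with
  | Var p | NegVar p => p
  | And g _ | Or g _ | Dia g | Box g | All g => some_var g
  end.

Lemma normalizable_ML {Phi : Type} (f : formula Phi) :
  is_ML f -> normalizable f.
Proof.
  intros Hf; set (p := some_var f).
  apply normalizable_equiv with (g := And f (All (Or (Var p) (NegVar p)))).
  - intros M w; simpl; split; [|tauto].
    intros H; split; [assumption | intros v; apply classic].
  - apply normalizable_clause; simpl; auto.
Qed.

Lemma normalizable_all_ML {Phi : Type} (f : formula Phi) :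
  is_ML f -> normalizable (All f).
Proof.
  (* The ML conjunct of the clause can be [f] itself, since [All f] entails [f] at the current
     point. *)
  intros Hf; apply normalizable_equiv with (g := And f (All f)).
  - intros M w; simpl; firstorder.
  - now apply normalizable_clause.
Qed.

Section UniversalQuantifier.

(** [Q] covers both [Box], where [R] is the accessibility relation, and [All], where [R] is the
    total relation. *)
Context {Phi : Type} (Q : formula Phi -> formula Phi).
Context (R : forall M : kripke_model Phi, M -> M -> Prop).
Hypothesis sat_Q : forall (M : kripke_model Phi) (w : M) (f : formula Phi),
  sat w (Q f) <-> forall v : M, R M w v -> sat v f.
Hypothesis normalizable_Q_ML :
  forall f : formula Phi, is_ML f -> normalizable (Q f).

(** The formula [b] accumulates the ML parts of clauses already removed, so the induction on [d]
    must keep it general. *)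
Lemma normalizable_Q_clauses (d b : formula Phi) :
  clauses d -> is_ML b -> normalizable (Q (Or d b)).
Proof.
  intros Hd; revert b; induction Hd as [g h Hg Hh | d g h Hd IH Hg Hh];
    intros b Hb.
  - apply normalizable_equiv with (g := Or (And (Q (Or g b)) (All h)) (Q b)).
    + intros M w; simpl; rewrite !sat_Q; simpl.
      (* If [All h] holds, the clause reduces to [g]; otherwise it is false everywhere and only [b]
         remains. *)
      destruct (classic (forall v : M, sat v h)); firstorder.
    + apply normalizable_or; [apply normalizable_and|].
      * apply normalizable_Q_ML; simpl; auto.
      * now apply normalizable_all_ML.
      * now apply normalizable_Q_ML.
  - apply normalizable_equiv with
      (* Here [g] joins the accumulator, and the induction hypothesis is used with both [Or g b] and
         [b]. *)
      (g := Or (And (Q (Or d (Or g b))) (All h)) (Q (Or d b))).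
    + intros M w; simpl; rewrite !sat_Q; simpl.
      destruct (classic (forall v : M, sat v h)); firstorder.
    + apply normalizable_or; [apply normalizable_and|].
      * apply IH; simpl; auto.
      * now apply normalizable_all_ML.
      * now apply IH.
Qed.

Lemma normalizable_Q (f : formula Phi) : normalizable f -> normalizable (Q f).
Proof.
  intros (d & Hd & Hfd); set (p := some_var f).
  (* The accumulator starts as a contradiction, the neutral element of disjunction. *)
  apply normalizable_equiv with (g := Q (Or d (And (Var p) (NegVar p)))).
  - intros M w; rewrite !sat_Q; split; intros H v Hv; specialize (H v Hv);
      specialize (Hfd M v); simpl in *; tauto.
  - apply normalizable_Q_clauses; simpl; auto.
Qed.

End UniversalQuantifier.

Lemma formula_normalizable {Phi : Type} (f : formula Phi) : normalizable f.
Proof.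
  induction f as [p | p | g IHg h IHh | g IHg h IHh | g IH | g IH | g IH].
  - now apply normalizable_ML.
  - now apply normalizable_ML.
  - now apply normalizable_and.
  - now apply normalizable_or.
  - now apply normalizable_dia.
  - apply (normalizable_Q (@Box Phi) (fun M => @rel Phi M)); [| |assumption].
    + reflexivity.
    + intros b Hb; now apply normalizable_ML.
  - apply (normalizable_Q (@All Phi) (fun _ _ _ => True)); [| |assumption].
    + simpl; firstorder.
    + apply normalizable_all_ML.
Qed.

Theorem theorem1 (Phi : Type) (phi : formula Phi) :
  exists psi : formula Phi, A_form psi /\ kripke_equiv phi psi.
Proof.
  destruct (formula_normalizable phi) as (d & Hd & Hphi).
  exists d; split; [right; now apply clauses_disjunctive_form | assumption].
Qed.
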